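(* Let $m\ge 2$ be an integer and $A=[a]_m$, $B=[b]_m\in\mathbb{Z}_m$ with $a,b\in\mathbb{Z}$. Let $d=\gcd(a,b,m)$ and let $m_1,m_2,A_2,B_1,B_2$ be as defined in the context. The following hold. 1. If $m_1\neq1$, then $B_1$ is an invertible element of $\mathbb{Z}_{m_1}$. 2. If $m_2\neq1$, then $B_2$ is a nilpotent element of $\mathbb{Z}_{m_2}$. If additionally $d=1$, then $A_2$ is an invertible element of $\mathbb{Z}_{m_2}$. 3. $B$ is nilpotent in $\mathbb{Z}_m$ if and only if $m_1=1$.
   Context: $\mathbb{Z}_s=\mathbb{Z}/s\mathbb{Z}$ and $[t]_s$ is the class of $t\in\mathbb{Z}$ in $\mathbb{Z}_s$. Write $m=\prod_{j=1}^r p_j^{k_j}$ with distinct primes $p_j$ and integers $k_j\ge1$. Put $m_1=\prod_{j:\,p_j\nmid b}p_j^{k_j}$, $m_2=\prod_{j:\,p_j\mid b}p_j^{k_j}$ (empty products are $1$). For $i=1,2$: $A_i=[a]_{m_i}$, $B_i=[b]_{m_i}$. *)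

(* Defs.v *)
From HB Require Import structures.
From mathcomp Require Import all_boot all_order all_algebra.

Set Implicit Arguments.
Unset Strict Implicit.
Unset Printing Implicit Defensive.

Import Order.TTheory GRing.Theory Num.Theory.

Local Open Scope ring_scope.

(* Pitfall: 'Z_s is Z/sZ only for s > 1 ('Z_0 and 'Z_1 are both Z/2Z), so
   [zclass s t] is to be used only under the assumption s > 1. *)
Definition zclass (s : nat) (t : int) : 'Z_s := t%:~R.

Definition nilpotent_elt (R : pzRingType) (x : R) : Prop :=
  exists n : nat, (0 < n)%N /\ x ^+ n = 0.

(* For m > 0, [primes m] lists the distinct primes p_j in the factorization
   of m, and [logn p m] is the exponent k_j of p = p_j. *)
Definition coprime_part (m : nat) (b : int) : nat :=
  (\prod_(p <- primes m | ~~ (p%:Z %| b)%Z) p ^ logn p m)%N.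

Definition common_part (m : nat) (b : int) : nat :=
  (\prod_(p <- primes m | (p%:Z %| b)%Z) p ^ logn p m)%N.

Definition gcd3 (a b : int) (m : nat) : int := gcdz (gcdz a b) m%:Z.

(* Main.v *)
(* A class [t]_s is nilpotent iff every prime factor of s divides t, and
   invertible iff none does; all claims are read off the prime factors of m_1
   and m_2, a common prime factor of m_2 and a being a common divisor of a, b
   and m. *)
Require Import Defs.
From HB Require Import structures.
From mathcomp Require Import all_boot all_order all_algebra.

Set Implicit Arguments.
Unset Strict Implicit.
Unset Printing Implicit Defensive.

Import Order.TTheory GRing.Theory Num.Theory.

Local Open Scope ring_scope.

(** [partn] multiplies over all [p <= m] in [pi]; outside [primes m] the exponent [logn p m] is 0,
    so these extra factors are 1. *)
Lemma prod_primes_partn (m : nat) (pi : nat_pred) : (0 < m)%N ->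
  (\prod_(p <- primes m | p \in pi) p ^ logn p m)%N = (m`_pi)%N.
Proof.
move=> m_gt0; rewrite -(filter_pi_of (ltnSn m)) big_filter_cond.
rewrite /partn big_mkcondl; apply: eq_bigr => p _.
case: ifPn => // p_m; have /eqP-> // : logn p m == 0%N.
by rewrite -leqn0 leqNgt logn_gt0.
Qed.

(** Composite divisors of [b] belong to it too; [partn] and [pnat] see only its primes. For [b = 0]
    it is all of [nat]. *)
Definition prime_factors_of (b : int) : nat_pred := [pred p : nat | p %| `|b|]%N.

Lemma coprime_partE (m : nat) (b : int) : (0 < m)%N ->
  coprime_part m b = (m`_(prime_factors_of b)^')%N.
Proof. by move=> m_gt0; rewrite -prod_primes_partn. Qed.

Lemma common_partE (m : nat) (b : int) : (0 < m)%N ->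
  common_part m b = (m`_(prime_factors_of b))%N.
Proof. by move=> m_gt0; rewrite -prod_primes_partn. Qed.

Lemma prime_coprime_dvdn (m n : nat) : (0 < m)%N ->
  (forall p, prime p -> p %| m -> ~~ (p %| n))%N -> coprime m n.
Proof.
move=> m_gt0 no_common; rewrite /coprime eqn_leq gcdn_gt0 m_gt0 andbT leqNgt.
apply/negP => /pdivP[p p_pr]; rewrite dvdn_gcd => /andP[pm pn].
by have := no_common p p_pr pm; rewrite pn.
Qed.

Lemma zclass_unit (s : nat) (t : int) : (1 < s)%N ->
  (zclass s t \is a GRing.unit) = coprime s `|t|.
Proof.
(* Write [t] as a sign times [|t|]: the sign is a unit, which leaves the class of a natural
   number. *)
move=> s_gt1; rewrite /zclass [in LHS](intEsign t) rmorphM rmorph_sign.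
by rewrite unitrMr ?unitrX ?unitrN1 // unitZpE.
Qed.

Lemma zclass_eq0 (s : nat) (t : int) : (1 < s)%N ->
  (zclass s t == 0) = (s %| `|t|)%N.
Proof.
move=> s_gt1; rewrite /zclass [in LHS](intEsign t) rmorphM rmorph_sign.
by rewrite mulr_sign; case: ifP => _; rewrite ?oppr_eq0 -val_eqE /= val_Zp_nat.
Qed.

Lemma nilpotent_zclass (s : nat) (t : int) : (1 < s)%N ->
  nilpotent_elt (zclass s t) <-> (prime_factors_of t).-nat s.
Proof.
move=> s_gt1; have s_gt0 := ltnW s_gt1.
have expE n : (zclass s t ^+ n == 0) = (s %| `|t| ^ n)%N.
  by rewrite -abszX -zclass_eq0 // /zclass rmorphXn.
split=> [[n [_ /eqP]]|t_nat].
  rewrite expE => s_dvd; apply/pnatP => // p p_pr p_s.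
  by have := dvdn_trans p_s s_dvd; rewrite Euclid_dvdX // => /andP[].
(* The exponent [s] works for all primes at once: [logn p s < s], so [p ^ logn p s] divides [p ^ s],
   hence [|t| ^ s] when [p] divides [t]. *)
exists s; split=> //; apply/eqP; rewrite expE; apply/dvdn_partP => // p p_s.
rewrite p_part (dvdn_trans (dvdn_exp2l p (ltnW (ltn_logl p s_gt0)))) //.
exact/dvdn_exp2r/(pnatPpi t_nat p_s).
Qed.

Theorem lemma2p2 (m : nat) (a b : int) (hm : (2 <= m)%N) :
  let d := gcd3 a b m in
  let m1 := coprime_part m b in
  let m2 := common_part m b in
  let B := zclass m b in
  let B1 := zclass m1 b in
  let A2 := zclass m2 a in
  let B2 := zclass m2 b in
  [/\ m1 <> 1%N -> B1 \is a GRing.unit,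
      m2 <> 1%N -> nilpotent_elt B2 /\ (d = 1 -> A2 \is a GRing.unit)
    & nilpotent_elt B <-> m1 = 1%N].
Proof.
move=> d m1 m2 B B1 A2 B2.
have m_gt0 : (0 < m)%N := ltnW hm.
have m1E : m1 = (m`_(prime_factors_of b)^')%N := coprime_partE b m_gt0.
have m2E : m2 = (m`_(prime_factors_of b))%N := common_partE b m_gt0.
have m1_nat : (prime_factors_of b)^'.-nat m1 by rewrite m1E part_pnat.
have m2_nat : (prime_factors_of b).-nat m2 by rewrite m2E part_pnat.
have m1_gt0 : (0 < m1)%N by rewrite m1E part_gt0.
have m2_gt0 : (0 < m2)%N by rewrite m2E part_gt0.
(* Both parts are positive, so being different from 1 puts them in the range where ['Z_s] really is
   the ring of integers mod [s]. *)
have gt1 n : (0 < n)%N -> n <> 1%N -> (1 < n)%N by case: n => [|[]].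
split=> [m1_neq1|m2_neq1|].
- rewrite zclass_unit ?gt1 //; apply: prime_coprime_dvdn => // p.
  exact: (elimT (pnatP _ m1_gt0) m1_nat p).
- have m2_gt1 := gt1 _ m2_gt0 m2_neq1.
  split=> [|d1]; first exact/nilpotent_zclass.
  rewrite zclass_unit //; apply: prime_coprime_dvdn => // p p_pr p_m2.
  apply/negP => p_a.
  have p_b : (p %| `|b|)%N := elimT (pnatP _ m2_gt0) m2_nat p p_pr p_m2.
  have p_m : (p %| m)%N by rewrite (dvdn_trans p_m2) // m2E dvdn_part.
  have : (p%:Z %| d)%Z by rewrite /d /gcd3 !dvdz_gcd !dvdzE p_a p_b.
  by rewrite d1 dvdzE Euclid_dvd1.
- apply: (iff_trans (nilpotent_zclass b hm)).
  (* The double complement gives [partn_eq1] its form: all primes of [m] divide [b] exactly when the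
     part of [m] prime to [b] is 1. *)
  by rewrite m1E -pnatNK -partn_eq1 //; split=> /eqP.
Qed.
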